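(* Let $s\in\mathbb R^+$ and $n\in\mathbb N_0$. In both items below, the parameters $\alpha,\beta$ are also assumed to satisfy $-(j+\alpha+\beta)\notin\mathbb N$ for all integers $j\ge 1$. The following identities hold for $x\in\Lambda=(-1,1)$. (i) For $\alpha>s-1$ (with $\alpha>-1$) and $\beta\in\mathbb R$, $$D_+^s\big\{{}^+J_{n}^{(-\alpha,\beta)}(x)\big\}=\frac{\Gamma(n+\alpha+1)}{\Gamma(n+\alpha-s+1)}\;{}^+J_{n}^{(-\alpha+s,\beta+s)}(x).$$ (ii) For $\alpha\in\mathbb R$ and $\beta>s-1$ (with $\beta>-1$), $$D_-^s\big\{{}^-J_{n}^{(\alpha,-\beta)}(x)\big\}=\frac{\Gamma(n+\beta+1)}{\Gamma(n+\beta-s+1)}\;{}^-J_{n}^{(\alpha+s,-\beta+s)}(x).$$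
   Context: $\mathbb N=\{1,2,\dots\}$, $\mathbb N_0=\{0\}\cup\mathbb N$, $\mathbb R^+=\{a\in\mathbb R: a>0\}$, $\Lambda=(-1,1)$. Riemann–Liouville fractional derivatives: for $s\in[k-1,k)$ with $k\in\mathbb N$ and $x\in\Lambda$, $$D_-^s v(x)=\frac{1}{\Gamma(k-s)}\frac{d^k}{dx^k}\int_{-1}^x\frac{v(y)}{(x-y)^{s-k+1}}dy,\qquad D_+^s v(x)=\frac{(-1)^k}{\Gamma(k-s)}\frac{d^k}{dx^k}\int_{x}^1\frac{v(y)}{(y-x)^{s-k+1}}dy.$$ Jacobi polynomials with arbitrary real parameters: for $\alpha,\beta\in\mathbb R$ and $n\in\mathbb N_0$, $$P_n^{(\alpha,\beta)}(x)=\sum_{j=0}^{n}\frac{(n+\alpha+\beta+1)_j\,(\alpha+j+1)_{n-j}}{j!\,(n-j)!}\Big(\frac{x-1}{2}\Big)^j,$$ where $(a)_0=1$ and $(a)_j=a(a+1)\cdots(a+j-1)$ for $j\ge1$. Generalized Jacobi functions (GJFs): for $x\in\Lambda$, $n\ge 0$, $${}^+J_n^{(-\alpha,\beta)}(x)=(1-x)^\alpha P_n^{(\alpha,\beta)}(x)\quad\text{for }\alpha>-1,\ \beta\in\mathbb R,$$ $${}^-J_n^{(\alpha,-\beta)}(x)=(1+x)^\beta P_n^{(\alpha,\beta)}(x)\quad\text{for }\alpha\in\mathbb R,\ \beta>-1.$$ *)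

(* Defs.v *)
From HB Require Import structures.
From mathcomp Require Import all_boot all_order all_algebra.
From mathcomp Require Import all_classical all_reals all_analysis.

Set Implicit Arguments.
Unset Strict Implicit.
Unset Printing Implicit Defensive.

Import Order.TTheory GRing.Theory Num.Theory.
Import numFieldNormedType.Exports.

Local Open Scope classical_set_scope.
Local Open Scope ring_scope.

Section Defs.
Context {R : realType}.
Implicit Types (s a b x z : R) (n k : nat) (v : R -> R).

(* Euler's integral represents the Gamma function for z > 0 only. *)
Definition Gamma z : R :=
  \int[lebesgue_measure]_(t in `]0, +oo[) (t `^ (z - 1) * expR (- t)).

(* The only k with k - 1 <= s < k, for s >= 0. *)
Definition RLorder s : nat := (Num.truncn s).+1.

Definition RLkernel_minus s v x y : R :=
  v y / (x - y) `^ (s - (RLorder s)%:R + 1).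

Definition RLkernel_plus s v x y : R :=
  v y / (y - x) `^ (s - (RLorder s)%:R + 1).

Definition RLint_minus s v x : R :=
  \int[lebesgue_measure]_(y in `](-1), x[) RLkernel_minus s v x y.

Definition RLint_plus s v x : R :=
  \int[lebesgue_measure]_(y in `]x, 1[) RLkernel_plus s v x y.

Definition RLD_minus s v x : R :=
  (Gamma ((RLorder s)%:R - s))^-1 * ((RLint_minus s v)^`(RLorder s))%classic x.

Definition RLD_plus s v x : R :=
  (-1) ^+ RLorder s / Gamma ((RLorder s)%:R - s)
    * ((RLint_plus s v)^`(RLorder s))%classic x.

(* The integral and the derivative above are total operators, with a default
   value where the integral or the derivative does not exist.  The predicates
   below say that D_-^s v and D_+^s v really exist at every point of (-1, 1). *)
Definition RLD_minus_exists s v : Prop :=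
  (forall x, -1 < x < 1 ->
     lebesgue_measure.-integrable `](-1), x[ (EFin \o RLkernel_minus s v x)) /\
  (forall j x, (j < RLorder s)%N -> -1 < x < 1 ->
     derivable (RLint_minus s v)^`(j)%classic x 1).

Definition RLD_plus_exists s v : Prop :=
  (forall x, -1 < x < 1 ->
     lebesgue_measure.-integrable `]x, 1[ (EFin \o RLkernel_plus s v x)) /\
  (forall j x, (j < RLorder s)%N -> -1 < x < 1 ->
     derivable (RLint_plus s v)^`(j)%classic x 1).

Definition pochhammer a j : R := \prod_(i < j) (a + i%:R).

Definition jacobi a b n x : R :=
  \sum_(j < n.+1)
    pochhammer (n%:R + a + b + 1) j * pochhammer (a + j%:R + 1) (n - j)
      / (j`!%:R * (n - j)`!%:R) * ((x - 1) / 2) ^+ j.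

(* The first two arguments are the superscripts of the generalized Jacobi
   functions: gjf_plus (- alpha) beta n is {}^+J_n^{(-alpha, beta)} and
   gjf_minus alpha (- beta) n is {}^-J_n^{(alpha, -beta)}. *)
Definition gjf_plus a b n x : R := (1 - x) `^ (- a) * jacobi (- a) b n x.

Definition gjf_minus a b n x : R := (1 + x) `^ (- b) * jacobi a (- b) n x.

End Defs.

(* Main.v *)
(* Expanding the Jacobi polynomial in powers of 1 - x reduces the first identity to
   the fractional derivative of (1 - x)^g for g = alpha + j,
     D_+^s (1 - x)^g = Gamma(g + 1) / Gamma(g - s + 1) * (1 - x)^(g - s),
   and the two sides then agree term by term, because s cancels in
   (alpha - s) + (beta + s) and Gamma(z) * z * ... * (z + m - 1) = Gamma(z + m).
   The derivative of a power comes from Gamma(p) Gamma(q) = B(p, q) Gamma(p + q),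
   proved by Tonelli's theorem.  The second identity is the same computation in
   powers of 1 + x, after the reflection P_n^(a,b)(-x) = (-1)^n P_n^(b,a)(x), a
   consequence of the Chu-Vandermonde identity that holds for all real a and b. *)

Require Import Defs.
From HB Require Import structures.
From mathcomp Require Import all_boot all_order all_algebra.
From mathcomp Require Import all_classical all_reals all_analysis.
From mathcomp Require Import measurable_realfun ring lra.

Import Order.TTheory GRing.Theory Num.Theory.
Import numFieldNormedType.Exports.

Local Open Scope classical_set_scope.
Local Open Scope ring_scope.

Local Notation mu := (@lebesgue_measure _).

(** * Affine changes of variable for Lebesgue integrals *)

Lemma measurable_affine {R : realType} (c a : R) :
  measurable_fun [set: R] (fun x : R => c * x + a).
Proof. by apply: measurable_funD => //; exact: measurable_funM. Qed.

(** The right-hand side is a measure in [A] with the correct value on half-open intervals, and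
    Lebesgue measure is the only one. *)
Lemma lebesgue_measure_affine {R : realType} (c a : R) (c0 : 0 < c) (A : set R) :
  measurable A ->
  mu A = (c%:E * mu ((fun x : R => c * x + a)%R @^-1` A))%E.
Proof.
move=> mA.
pose phi : measurableTypeR R -> measurableTypeR R := fun x : R => c * x + a.
have mphi : measurable_fun [set: measurableTypeR R] phi by exact: measurable_affine.
pose c' := NngNum (ltW c0).
pose m := measure_function_pushforward__canonical__measure_function_Measure mu mphi.
transitivity (mscale c' m A); last by [].
apply: lebesgue_measure_unique => //.
move=> _ [[l r]] _ <-.
transitivity (c%:E * mu (phi @^-1` `]l, r]))%E; last by [].
have pre : phi @^-1` `]l, r] = `](l - a) / c, (r - a) / c]%classic.
  apply/seteqP; split => x /=; rewrite !in_itv/= /phi ltr_pdivrMr ?ler_pdivlMr//;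
    by rewrite ltrBlDr lerBrDr mulrC.
rewrite pre !lebesgue_measure_itv/= !lte_fin ltr_pM2r ?invr_gt0// ltrD2r.
case: ifPn => _; last by rewrite mule0.
by rewrite -!EFinB -EFinM; congr EFin; field; rewrite gt_eqF.
Qed.

Lemma ge0_integral_scale_shift {R : realType} (f : R -> \bar R) (c a : R) :
  0 < c -> measurable_fun setT f -> (forall x, 0 <= f x)%E ->
  (\int[mu]_x f x = c%:E * \int[mu]_x f (c * x + a)%R)%E.
Proof.
move=> c0 mf f0.
pose phi : measurableTypeR R -> measurableTypeR R := fun x : R => c * x + a.
have mphi : measurable_fun [set: measurableTypeR R] phi by exact: measurable_affine.
rewrite -[X in (_ * X)%E](ge0_integral_pushforward mphi mu (D := setT) (f := f))//.
pose c' := NngNum (ltW c0).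
pose m := measure_function_pushforward__canonical__measure_function_Measure mu mphi.
rewrite -[RHS](ge0_integral_mscale m measurableT c')//.
by apply: eq_measure_integral => A mA _; exact: lebesgue_measure_affine.
Qed.

Lemma ge0_integral_shift {R : realType} (f : R -> \bar R) (a : R) :
  measurable_fun setT f -> (forall x, 0 <= f x)%E ->
  (\int[mu]_x f x = \int[mu]_x f (x + a)%R)%E.
Proof.
move=> mf f0; rewrite (ge0_integral_scale_shift f 1 a)// mul1e.
by under eq_integral do rewrite mul1r.
Qed.

Lemma ge0_integral_reflect {R : realType} (f : R -> \bar R) (a : R) :
  measurable_fun setT f -> (forall x, 0 <= f x)%E ->
  (\int[mu]_x f x = \int[mu]_x f (a - x)%R)%E.
Proof.
move=> mf f0.
have mphi : measurable_fun [set: measurableTypeR R]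
  (-%R : measurableTypeR R -> measurableTypeR R) by exact: oppr_measurable.
pose g x := f (x + a).
have mg : measurable_fun setT g.
  by apply: measurableT_comp => //; apply: measurable_funD.
have g0 x : (0 <= g x)%E by exact: f0.
rewrite (ge0_integral_shift f a)//.
under [RHS]eq_integral do rewrite addrC.
rewrite -[RHS](ge0_integral_pushforward mphi mu (D := setT) (f := g))//.
by apply: eq_measure_integral => A mA _; exact/esym/lebesgue_measureN.
Qed.

(** * Convolution of truncated powers and the Beta-Gamma identity *)

Section truncated_powers.
Context {R : realType}.
Implicit Types p q t u x : R.

(* With the cut-off at 0, the convolution over the whole line of two such powers
   is a power again, and its value is Euler's Beta integral. *)
Definition ppow p x : R := \1_`]0, +oo[%classic x * x `^ (p - 1).

Lemma ppow_gt0E p x : 0 < x -> ppow p x = x `^ (p - 1).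
Proof. by move=> x0; rewrite /ppow indicE mem_set ?mul1r//= in_itv/= x0. Qed.

Lemma ppow_le0E p x : x <= 0 -> ppow p x = 0.
Proof.
by move=> x0; rewrite /ppow indicE memNset ?mul0r//= in_itv/= andbT ltNge x0.
Qed.

Lemma ppow_ge0 p x : 0 <= ppow p x.
Proof. by rewrite mulr_ge0// ?powR_ge0// indicE. Qed.

Lemma measurable_ppow p : measurable_fun setT (ppow p).
Proof.
apply: measurable_funM; first exact: measurable_indic.
exact: measurable_powR.
Qed.

Lemma measurable_conv_ppow p q t :
  measurable_fun setT (fun x => (ppow p x * ppow q (t - x))%:E).
Proof.
apply/measurable_EFinP; apply: measurable_funM; first exact: measurable_ppow.
apply: (measurableT_comp (measurable_ppow q)).
exact: measurable_funB.
Qed.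

Lemma measurable_ppow_expR p :
  measurable_fun setT (fun x => (ppow p x * expR (- x))%:E).
Proof.
apply/measurable_EFinP; apply: measurable_funM; first exact: measurable_ppow.
by apply: measurableT_comp => //; exact: oppr_measurable.
Qed.

(** Values lie in [\bar R], so that identities can be proved before convergence is known. The two
    cut-offs restrict u to ]0, 1[. *)
Definition EBeta p q : \bar R := (\int[mu]_u (ppow p u * ppow q (1 - u))%R%:E)%E.

Definition EGamma p : \bar R := (\int[mu]_x (ppow p x * expR (- x))%R%:E)%E.

Lemma EBeta_ge0 p q : (0 <= EBeta p q)%E.
Proof. by apply: integral_ge0 => x _; rewrite lee_fin mulr_ge0 ?ppow_ge0. Qed.

Lemma EGamma_ge0 p : (0 <= EGamma p)%E.
Proof. by apply: integral_ge0 => x _; rewrite lee_fin mulr_ge0 ?ppow_ge0 ?expR_ge0. Qed.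

(** For t > 0 the substitution x = t u extracts every power of t and leaves Euler's integral. For t
    <= 0, x and t - x are never both positive. *)
Lemma conv_ppow p q t :
  (\int[mu]_x (ppow p x * ppow q (t - x))%R%:E = EBeta p q * (ppow (p + q) t)%R%:E)%E.
Proof.
have [t0|t0] := leP t 0.
  rewrite (ppow_le0E _ _ t0) mule0 integral0_eq// => x _.
  have [x0|x0] := leP x 0; first by rewrite (ppow_le0E _ _ x0) mul0r.
  by rewrite (ppow_le0E q) ?mulr0// subr_le0 (le_trans t0)// ltW.
rewrite (ge0_integral_scale_shift _ t 0)//; last 2 first.
- exact: measurable_conv_ppow.
- by move=> x; rewrite lee_fin mulr_ge0 ?ppow_ge0.
have ppowM r x : ppow r (t * x) = t `^ (r - 1) * ppow r x.
  have [x0|x0] := leP x 0.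
    by rewrite !ppow_le0E ?mulr0// pmulr_rle0.
  by rewrite !ppow_gt0E ?powRM ?mulr_gt0// ltW.
under eq_integral.
  move=> x _.
  rewrite addr0 -{2}[t]mulr1 -mulrBr !ppowM.
  rewrite (_ : _ * _ * _ = (t `^ (p - 1) * t `^ (q - 1)) * (ppow p x * ppow q (1 - x))); last by ring.
  rewrite EFinM.
  over.
rewrite (@ge0_integralZl_EFin _ _ _ mu setT)//; last 3 first.
- by move=> x _; rewrite lee_fin mulr_ge0 ?ppow_ge0.
- exact: measurable_conv_ppow.
- by rewrite mulr_ge0 ?powR_ge0.
rewrite [RHS]muleC (ppow_gt0E _ _ t0) -/(EBeta p q).
rewrite muleA -EFinM; congr (_%:E * _)%E.
(* The Jacobian t is read as t^1; the exponents then add up to p + q - 1. *)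
rewrite -{1}(powRr1 (ltW t0)) -!powRD ?(gt_eqF t0) ?implybT//.

by congr (_ `^ _); ring.
Qed.

(** In the double integral for the product, the sum t of the two variables replaces the second one.
    The exponential becomes exp(-t), so after exchanging the integrals the inner one is
    [conv_ppow]. *)
Lemma EGamma_EBeta p q : (EGamma p * EGamma q = EBeta p q * EGamma (p + q)%R)%E.
Proof.
have g0 r x : (0 <= (ppow r x * expR (- x))%:E)%E.
  by rewrite lee_fin mulr_ge0 ?ppow_ge0 ?expR_ge0.
rewrite /EGamma muleC -ge0_integralZl//; last 2 first.
- exact: measurable_ppow_expR.
- exact: EGamma_ge0.
rewrite /EGamma -[RHS](ge0_integralZl mu measurableT (measurable_ppow_expR (p + q))
  (fun x _ => g0 _ x) (EBeta_ge0 p q)).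
pose f (z : R * R) := (ppow p z.1 * ppow q (z.2 - z.1) * expR (- z.2))%:E.
have mf : measurable_fun setT f.
  apply/measurable_EFinP; apply: measurable_funM; first apply: measurable_funM.
  - apply: (measurableT_comp (measurable_ppow p)); exact: measurable_fst.
  - apply: (measurableT_comp (measurable_ppow q)).
    by apply: measurable_funB; [exact: measurable_snd|exact: measurable_fst].
  - apply: measurableT_comp => //; apply: measurable_funN; exact: measurable_snd.
have f0 z : (0 <= f z)%E.
  by rewrite lee_fin mulr_ge0 ?expR_ge0// mulr_ge0 ?ppow_ge0.
transitivity (\int[mu]_x \int[mu]_y f (x, y))%E.
  apply: eq_integral => x _.
  rewrite (ge0_integral_shift _ (- x) (measurable_ppow_expR q) (g0 q)) muleC.
  rewrite -ge0_integralZl//; last first.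
    apply: (measurableT_comp (measurable_ppow_expR q)); exact: measurable_funB.
  apply: eq_integral => y _; rewrite /f/= -EFinM; congr EFin.
  rewrite [LHS]mulrACA -expRD; congr (_ * expR _); ring.
transitivity (\int[mu]_y \int[mu]_x f (x, y))%E.
  exact: (@fubini_tonelli _ _ _ _ R mu mu f mf f0).
apply: eq_integral => t _; rewrite /f/=.
under eq_integral do rewrite mulrC EFinM.
rewrite ge0_integralZl_EFin ?expR_ge0//; last 2 first.
- by move=> x _; rewrite lee_fin mulr_ge0 ?ppow_ge0.
- exact: measurable_conv_ppow.
by rewrite conv_ppow muleC -muleA -EFinM.
Qed.

End truncated_powers.

(** * Finiteness, positivity and functional equation of Gamma *)

Section gamma_beta.
Context {R : realType}.
Implicit Types p q t u x : R.

Lemma EGammaE p :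
  EGamma p = (\int[mu]_(t in `]0%R, +oo[) (t `^ (p - 1) * expR (- t))%:E)%E.
Proof.
rewrite integral_mkcond; apply: eq_integral => t _.
rewrite patchE /ppow indicE; case: ifPn => _; first by rewrite mul1r.
by rewrite !mul0r.
Qed.

(** This is the total mass of the exponential law of rate 1. *)
Lemma EGamma1 : EGamma 1 = 1%E :> \bar R.
Proof.
rewrite EGammaE integral_itv_obnd_cbnd; last first.
  apply: measurable_funTS; apply/measurable_EFinP; apply: measurable_funM.
    exact: measurable_powR.
  by apply: measurableT_comp => //; exact: oppr_measurable.
rewrite -(@integral_exponential_pdf R 1 ltr01) integral_mkcond.
apply: eq_integral => t _.
rewrite /exponential_pdf !patchE; case: ifPn => // _.
by rewrite subrr powRr0 !mul1r mulN1r.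
Qed.

(** For p < 1 the integrand blows up at 0, so the fundamental theorem of calculus is first applied
    away from 0. *)
Lemma integral_itvcc_powR p a : 0 < p -> 0 < a < 1 ->
  (\int[mu]_(x in `[a, 1%R]) (x `^ (p - 1))%:E = (p^-1 - p^-1 * a `^ p)%:E)%E.
Proof.
move=> p0 /andP[a0 a1].
have dF x : 0 < x -> is_derive x 1 (fun y : R => p^-1 * y `^ p) (x `^ (p - 1)).
  move=> x0; have := is_deriveZ p^-1 (is_derive1_powR p x0).
  by rewrite /GRing.scale/= mulKf ?gt_eqF.
have cpow r x : 0 < x -> {for x, continuous (fun y : R => y `^ r)}.
  move=> x0; apply: differentiable_continuous; apply/derivable1_diffP.
  by have [] := is_derive1_powR r x0.
have cF x : 0 < x -> {for x, continuous (fun y : R => p^-1 * y `^ p)}.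
  move=> x0; apply: differentiable_continuous; apply/derivable1_diffP.
  by have [] := dF x x0.
rewrite (continuous_FTC2 (F := fun y => p^-1 * y `^ p) a1).
- by rewrite powR1 mulr1 EFinB.
- apply: continuous_in_subspaceT => x; rewrite inE/= in_itv/= => /andP[ax _].
  exact/cpow/(lt_le_trans a0).
- split.
  + move=> x; rewrite in_itv/= => /andP[ax _].
    by have [] := dF x (lt_trans a0 ax).
  + by apply: cvg_at_right_filter; exact: cF.
  + by apply: cvg_at_left_filter; exact: cF.
- move=> x; rewrite in_itv/= => /andP[ax _].
  by rewrite derive1E; have [_ ->] := dF x (lt_trans a0 ax).
Qed.

Lemma integral_itvoc_powR p : 0 < p ->
  (\int[mu]_(x in `]0%R, 1%R]) (x `^ (p - 1))%:E = (p^-1)%:E)%E.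
Proof.
move=> p0.
(* The intervals [a n, 1] increase to ]0, 1], for monotone convergence. Starting from 1/2 keeps
   [a n < 1] strict at n = 0. *)
pose a (n : nat) : R := n.+2%:R^-1.
have a01 n : 0 < a n < 1.
  by rewrite /a invr_gt0 ltr0n/= invf_lt1 ?ltr0n// ltr1n.
have a_nincr n m : (n <= m)%N -> a m <= a n.
  by move=> nm; rewrite lef_pV2 ?posrE ?ltr0n// ler_nat !ltnS.
have UE : `]0%R, 1%R]%classic = \bigcup_n `[a n, 1%R]%classic.
  apply/seteqP; split => x /=.
    rewrite in_itv/= => /andP[x0 x1]; exists (Num.truncn x^-1) => //=.
    rewrite in_itv/= x1 andbT -[leRHS]invrK lef_pV2 ?posrE ?ltr0n ?invr_gt0//.
    by rewrite (le_trans (ltW (truncnS_gt _)))// ler_nat.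
  move=> [n _]/=; rewrite !in_itv/= => /andP[anx ->]; rewrite andbT.
  by have /andP[an0 _] := a01 n; exact: lt_le_trans an0 anx.
have h1 : (\int[mu]_(x in `[a n, 1%R]) (x `^ (p - 1))%:E)%E @[n --> \oo] -->
    (\int[mu]_(x in `]0%R, 1%R]) (x `^ (p - 1))%:E)%E.
  rewrite UE; apply: ge0_nondecreasing_set_cvg_integral => //.
  - move=> n m nm; apply/subsetPset => x/=; rewrite !in_itv/= => /andP[anx ->].
    by rewrite andbT (le_trans _ anx)// a_nincr.
  - move=> n; apply: measurable_funTS; apply/measurable_EFinP.
    exact: measurable_powR.
  - by move=> n x _; rewrite lee_fin powR_ge0.
have h2 : (\int[mu]_(x in `[a n, 1%R]) (x `^ (p - 1))%:E)%E @[n --> \oo] -->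
    (p^-1)%:E.
  under eq_fun do rewrite integral_itvcc_powR//.
  apply: cvg_EFin; first by near=> n.
  rewrite -[X in _ --> X]subr0; apply: cvgB; first exact: cvg_cst.
  rewrite -[X in _ --> X](mulr0 p^-1); apply: cvgMr.
  have /cvg_at_rightP := powR_cvg0 p0; apply; split.
    by move=> n; have /andP[] := a01 n.
  by have := @cvg_harmonic R; rewrite -(cvg_shiftS (harmonic : R^nat)).
exact: (cvg_unique _ h1 h2).
Unshelve. all: by end_near. Qed.

Lemma EBeta1 p : 0 < p -> EBeta p 1 = (p^-1)%:E.
Proof.
move=> p0; rewrite -integral_itvoc_powR// -integral_itv_bndo_bndc; last first.
  apply: measurable_funTS; apply/measurable_EFinP; exact: measurable_powR.
rewrite integral_mkcond; apply: eq_integral => u _.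
rewrite patchE; case: ifPn.
  rewrite inE/= in_itv/= => /andP[u0 u1].
  by rewrite !ppow_gt0E ?subr_gt0// subrr powRr0 mulr1.
rewrite notin_setE/= in_itv/= => /negP; rewrite negb_and -!leNgt => /orP[u0|u1].
  by rewrite ppow_le0E// mul0r.
by rewrite (ppow_le0E 1) ?mulr0// subr_le0.
Qed.

(* Stated in [\bar R] because the finiteness of Gamma is deduced from it. *)
Lemma EGammaS p : 0 < p -> EGamma (p + 1) = (p%:E * EGamma p)%E.
Proof.
move=> p0; have := EGamma_EBeta p 1.
rewrite EGamma1 mule1 (EBeta1 p p0) => ->.
by rewrite muleA -EFinM mulfV ?gt_eqF// mul1e.
Qed.

(** The integrand is at most x^(p-1) on ]0, 1[ and, as p <= 1, at most exp(-x) on [1, +oo[. The two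
    majorants integrate to [EBeta p 1] and at most [EGamma 1]. *)
Lemma EGamma_lty_le1 p : 0 < p <= 1 -> (EGamma p < +oo)%E.
Proof.
move=> /andP[p0 p1].
apply: (@le_lt_trans _ _ (EBeta p 1 + EGamma 1)%E); last first.
  by rewrite EGamma1 EBeta1// ltry.
rewrite /EBeta /EGamma -ge0_integralD//; last 4 first.
- by move=> x _; rewrite lee_fin mulr_ge0 ?ppow_ge0.
- exact: measurable_conv_ppow.
- by move=> x _; rewrite lee_fin mulr_ge0 ?ppow_ge0 ?expR_ge0.
- exact: measurable_ppow_expR.
apply: ge0_le_integral => //.
- by move=> x _; rewrite lee_fin mulr_ge0 ?ppow_ge0 ?expR_ge0.
- exact: measurable_ppow_expR.
- apply: emeasurable_funD; first exact: measurable_conv_ppow.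
  exact: measurable_ppow_expR.
move=> x _; rewrite -EFinD lee_fin.
have [x0|x0] := leP x 0; first by rewrite !(ppow_le0E _ x)// !mul0r addr0.
have [x1|x1] := leP 1 x.
  rewrite [ppow 1 (1 - x)]ppow_le0E ?subr_le0// mulr0 add0r.
  rewrite ler_wpM2r ?expR_ge0// !ppow_gt0E// ler_powR// lerD2r//.
apply: ler_wpDr; first by rewrite mulr_ge0 ?ppow_ge0 ?expR_ge0.
rewrite ler_wpM2l ?ppow_ge0// ppow_gt0E ?subr_gt0// subrr powRr0.
by rewrite -expR0 ler_expR oppr_le0 ltW.
Qed.

Lemma EGamma_lty p : 0 < p -> (EGamma p < +oo)%E.
Proof.
move=> p0; have [n] : exists n : nat, p <= n.+1%:R.
  by exists (Num.truncn p); exact/ltW/truncnS_gt.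
elim: n p p0 => [|n ih] p p0 pn; first by rewrite EGamma_lty_le1// p0.
have [p1|p1] := leP p 1; first by rewrite EGamma_lty_le1// p0.
have p'0 : 0 < p - 1 by rewrite subr_gt0.
rewrite -(subrK 1 p) EGammaS// lte_mul_pinfty// ?lee_fin ?ltW//.
by apply: ih => //; rewrite lerBlDr natr1.
Qed.

(** On ]0, 1[ the exponential is at least exp(-1), which gives the lower bound exp(-1) / p. *)
Lemma EGamma_gt0 p : 0 < p -> (0 < EGamma p)%E.
Proof.
move=> p0; apply: (@lt_le_trans _ _ ((expR (- 1))%:E * EBeta p 1)%E).
  by rewrite EBeta1// -EFinM lte_fin mulr_gt0 ?expR_gt0 ?invr_gt0.
rewrite /EBeta -ge0_integralZl_EFin ?expR_ge0//; last 2 first.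
- by move=> x _; rewrite lee_fin mulr_ge0 ?ppow_ge0.
- exact: measurable_conv_ppow.
apply: ge0_le_integral => //.
- by move=> x _; rewrite -EFinM lee_fin mulr_ge0 ?expR_ge0// mulr_ge0 ?ppow_ge0.
- apply: measurable_funeM; exact: measurable_conv_ppow.
- exact: measurable_ppow_expR.
move=> x _; rewrite -EFinM lee_fin mulrCA ler_wpM2l ?ppow_ge0//.
have [x1|x1] := leP 1 x; first by rewrite ppow_le0E ?subr_le0// mulr0 expR_ge0.
rewrite ppow_gt0E ?subr_gt0// subrr powRr0 mulr1 ler_expR lerN2 ltW//.
Qed.

(** [Gamma] is the [fine] part of the integral, which would be 0 if the integral diverged;
    finiteness makes the two agree. *)
Lemma EGamma_fin p : 0 < p -> EGamma p = (Gamma p)%:E.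
Proof.
move=> p0; rewrite /Gamma /Rintegral -EGammaE fineK//.
by rewrite ge0_fin_numE ?EGamma_ge0 ?EGamma_lty.
Qed.

Lemma Gamma_gt0 p : 0 < p -> 0 < Gamma p.
Proof. by move=> p0; rewrite -lte_fin -EGamma_fin// EGamma_gt0. Qed.

Lemma GammaS p : 0 < p -> Gamma (p + 1) = p * Gamma p.
Proof.
move=> p0; have p10 : 0 < p + 1 by rewrite addr_gt0.
by have := EGammaS p p0; rewrite !EGamma_fin// => -[].
Qed.

Lemma EBeta_fin p q : 0 < p -> 0 < q ->
  EBeta p q = (Gamma p * Gamma q / Gamma (p + q))%:E.
Proof.
move=> p0 q0; have pq0 : 0 < p + q by rewrite addr_gt0.
have := EGamma_EBeta p q; rewrite !EGamma_fin// -EFinM => h.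
have G0 : Gamma (p + q) != 0 by rewrite gt_eqF// Gamma_gt0.
rewrite EFinM h -muleA -EFinM mulfV// mule1//.
Qed.

Lemma Gamma_pochhammer p (m : nat) : 0 < p ->
  Gamma (p + m%:R) = pochhammer p m * Gamma p.
Proof.
move=> p0; elim: m => [|m ih]; first by rewrite addr0 /pochhammer big_ord0 mul1r.
rewrite -natr1 addrA GammaS ?ih; last by rewrite ltr_wpDr.
by rewrite /pochhammer big_ord_recr/= mulrCA mulrA.
Qed.

End gamma_beta.

(** * Iterated derivatives of linear combinations of powers *)

Section linear_combinations_of_powers.
Context {R : realType}.
Implicit Types (x r e : R) (m : nat).

(** The factor that m derivatives of u^r produce. *)
Definition falling r m : R := \prod_(i < m) (r - i%:R).

Lemma is_derive_affine_powR e r x : 0 < 1 + e * x ->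
  is_derive x 1 (fun y : R => (1 + e * y) `^ r) (e * r * (1 + e * x) `^ (r - 1)).
Proof.
move=> x0.
have h : is_derive x 1 (fun y : R => 1 + e * y) e.
  have := is_deriveD (is_derive_cst (1 : R) x 1) (is_deriveZ e (is_derive_id x 1)).
  by rewrite add0r /GRing.scale/= mulr1.
have := @is_derive1_comp _ (fun y : R => y `^ r) (fun y : R => 1 + e * y) _ _ _ (is_derive1_powR r x0) h.
by rewrite mulrC mulrA.
Qed.

Lemma near_itvN11 (P : R -> Prop) x :
  (forall y, -1 < y < 1 -> P y) -> -1 < x < 1 -> \forall y \near x, P y.
Proof.
move=> h /andP[x1 x2]; near=> y; apply: h; apply/andP; split.
- by near: y; exact: lt_nbhsr.
- by near: y; exact: lt_nbhsl.
Unshelve. all: by end_near. Qed.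

Lemma is_derive_eq_on_itvN11 (f g : R -> R) x d :
  (forall y, -1 < y < 1 -> f y = g y) -> -1 < x < 1 ->
  is_derive x 1 g d -> is_derive x 1 f d.
Proof.
move=> fg x11; apply: near_eq_is_derive.
by apply: (near_itvN11 (fun y => g y = f y)) => // y /fg.
Qed.

Lemma is_derive_sum_affine_powR (n : nat) (c r : 'I_n -> R) e x :
  0 < 1 + e * x ->
  is_derive x 1 (fun y : R => \sum_(j < n) c j * (1 + e * y) `^ r j)
    (\sum_(j < n) c j * (e * r j * (1 + e * x) `^ (r j - 1))).
Proof.
move=> x0.
rewrite (_ : (fun y => _) =
  \sum_(j < n) (fun y : R => c j * (1 + e * y) `^ r j)); last first.
  by apply/funext => y; rewrite fct_sumE.
apply: is_derive_sum => j.
exact: (is_deriveZ (c j) (is_derive_affine_powR e (r j) x x0)).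
Qed.

(** The sign e treats powers of 1 + x and of 1 - x together, with base positive on ]-1, 1[. As this
    interval is open, a formula for [f] there determines all its derivatives there. *)
Lemma derive1n_sum_powR (n : nat) (c r : 'I_n -> R) e (f : R -> R) m :
  `|e| = 1 ->
  (forall x, -1 < x < 1 -> f x = \sum_(j < n) c j * (1 + e * x) `^ r j) ->
  forall x, -1 < x < 1 ->
    (f^`(m))%classic x =
      \sum_(j < n) c j * (e ^+ m * falling (r j) m * (1 + e * x) `^ (r j - m%:R)) /\
    derivable (f^`(m))%classic x 1.
Proof.
move=> e1 fE.
have pos x : -1 < x < 1 -> 0 < 1 + e * x.
  move=> x11.
  have : `|e * x| < 1 by rewrite normrM e1 mul1r ltr_norml.
  by rewrite ltr_norml => /andP[? _]; lra.
(* The formula at order k on the whole interval gives the derivative at each point. It serves both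
   the induction and the final derivability claim. *)
have drv k : (forall x, -1 < x < 1 -> (f^`(k))%classic x =
      \sum_(j < n) c j * (e ^+ k * falling (r j) k * (1 + e * x) `^ (r j - k%:R))) ->
    forall x, -1 < x < 1 -> is_derive x 1 (f^`(k))%classic
      (\sum_(j < n) c j * (e ^+ k.+1 * falling (r j) k.+1 * (1 + e * x) `^ (r j - k.+1%:R))).
  move=> fk x x11; apply: (is_derive_eq_on_itvN11 _
    (fun y => \sum_(j < n) (c j * (e ^+ k * falling (r j) k)) * (1 + e * y) `^ (r j - k%:R))).
  - by move=> y y11; rewrite fk//; apply: eq_bigr => j _; rewrite !mulrA.
  - exact: x11.
  - apply: is_derive_eq; first exact: is_derive_sum_affine_powR (pos _ x11).
    apply: eq_bigr => j _; rewrite /falling big_ord_recr/= exprSr.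
    rewrite (_ : r j - k%:R - 1 = r j - k.+1%:R); last by rewrite -natr1; ring.
    ring.
have val k : forall x, -1 < x < 1 -> (f^`(k))%classic x =
      \sum_(j < n) c j * (e ^+ k * falling (r j) k * (1 + e * x) `^ (r j - k%:R)).
  elim: k => [|k ih] x x11.
    rewrite derive1n0 fE//; apply: eq_bigr => j _.
    by rewrite /falling big_ord0 expr0 !mul1r subr0.
  by rewrite derive1nS derive1E; have [_ ->] := drv k ih x x11.
move=> x x11; split; first exact: val.
by have [] := drv m (val m) x x11.
Qed.

End linear_combinations_of_powers.

(** * Chu-Vandermonde and the reflection of Jacobi polynomials *)

Section jacobi_reflection.
Context {R : realType}.
Implicit Types (a b x y : R) (n m i j : nat).

Lemma pochhammer0 a : pochhammer a 0 = 1.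
Proof. by rewrite /pochhammer big_ord0. Qed.

Lemma pochhammerSr a n : pochhammer a n.+1 = pochhammer a n * (a + n%:R).
Proof. by rewrite /pochhammer big_ord_recr. Qed.

Lemma pochhammerD a n m :
  pochhammer a (n + m) = pochhammer a n * pochhammer (a + n%:R) m.
Proof.
elim: m => [|m ih]; first by rewrite addn0 pochhammer0 mulr1.
by rewrite addnS !pochhammerSr ih -mulrA -addrA natrD.
Qed.

(** Read backwards, the factors a + i are the negatives of those on the right. *)
Lemma pochhammer_reflect a m :
  pochhammer a m = (-1) ^+ m * pochhammer (1 - a - m%:R) m.
Proof.
have := prodrN (fun _ : 'I_m => true) (fun i : 'I_m => 1 - a - m%:R + i%:R).
rewrite card_ord /pochhammer => <-.
rewrite (reindex_inj rev_ord_inj)/=; apply: eq_bigr => i _.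
by rewrite natrB; [rewrite -natr1; ring|exact: ltn_ord].
Qed.

Lemma pochhammer_vandermonde x y n :
  \sum_(l < n.+1) pochhammer x l * pochhammer y (n - l) *+ 'C(n, l)
  = pochhammer (x + y) n.
Proof.
elim: n => [|n ih]; first by rewrite big_ord1 !pochhammer0 mulr1.
rewrite pochhammerSr -ih big_distrl/= big_ord_recl/= bin0 subn0.
under eq_bigr do rewrite /bump/= add1n subSS binS mulrnDr.
rewrite big_split/= addrA -[X in X + _ = _]addrC.
(* Of the two sums from Pascal's rule, this one absorbs the isolated term l = 0 when its index is
   shifted back; its last binomial coefficient is zero. *)
have -> : \sum_(i < n.+1) pochhammer x i.+1 * pochhammer y (n - i) *+ 'C(n, i.+1)
    + pochhammer x 0 * pochhammer y n.+1 *+ 1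
  = \sum_(i < n.+1) pochhammer x i * pochhammer y (n.+1 - i) *+ 'C(n, i).
  have := @big_ord_recl _ 0 +%R n.+1
    (fun i : 'I_n.+2 => pochhammer x i * pochhammer y (n.+1 - i) *+ 'C(n, i)).
  rewrite /= bin0 subn0 => /esym.
  under eq_bigr do rewrite /bump/= add1n subSS.
  by rewrite addrC => ->; rewrite big_ord_recr/= bin_small// addr0.
rewrite -big_split/=; apply: eq_bigr => l _.
have ln : (l <= n)%N by rewrite -ltnS ltn_ord.
(* The new factors y + n - l and x + l add up to x + y + n. *)
rewrite subSn// !pochhammerSr natrB// -!(mulr_natr (_ * _)); ring.
Qed.

Definition jacobi_coef a b n j : R :=
  pochhammer (n%:R + a + b + 1) j * pochhammer (a + j%:R + 1) (n - j)
    / (j`!%:R * (n - j)`!%:R).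

(** With u = (x - 1) / 2, the left side is the coefficient of u^i in P_n^(a,b)(-x), once each power
    of 1 + u is expanded. *)
Lemma jacobi_coef_reflect a b n i : (i <= n)%N ->
  \sum_(j < n.+1) jacobi_coef a b n j * (-1) ^+ j * 'C(j, i)%:R =
  (-1) ^+ n * jacobi_coef b a n i.
Proof.
move=> i_n; rewrite -(subnKC i_n); move: (n - i)%N => m {n i_n}.
(* Terms with j < i vanish; the others are indexed by j = i + l. *)
rewrite -addnS big_split_ord/= big1 ?add0r; last first.
  by move=> j _; rewrite bin_small ?ltn_ord// mulr0.
have fact_neq0 k : k`!%:R != 0 :> R by rewrite pnatr_eq0 -lt0n fact_gt0.
pose c := (i + m)%:R + a + b + 1.
have -> : jacobi_coef b a (i + m) i =
    pochhammer c i / (i`!%:R * m`!%:R) * pochhammer (b + i%:R + 1) m.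
  rewrite /jacobi_coef addKn (_ : _ + b + a + 1 = c); last by rewrite /c; ring.
  by rewrite mulrAC.
(* This splitting fits Chu-Vandermonde: [pochhammerD] produces the base c + i, and
   [pochhammer_reflect] turns (a+j+1)_(n-j) into a symbol of base -(a+n), the same for all j. *)
have -> : b + i%:R + 1 = (c + i%:R) + (- (a + (i + m)%:R)).
  rewrite /c; ring.
rewrite -(pochhammer_vandermonde (c + i%:R)) mulrA mulr_sumr; apply: eq_bigr => l _.
have lm : (l <= m)%N by rewrite -ltnS ltn_ord.
rewrite /jacobi_coef subnDl -/c pochhammerD.
rewrite [pochhammer (a + _ + 1) _]pochhammer_reflect.
rewrite (_ : 1 - _ - _ = - (a + (i + m)%:R)); last by rewrite natrB// !natrD; ring.
rewrite -(mulr_natr (_ * _)).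
have H1 : 'C(i + l, i)%:R = (i + l)`!%:R / (i`!%:R * l`!%:R) :> R.
  apply: (canRL (mulfK _)); first by rewrite mulf_neq0.
  by rewrite -!natrM -(@bin_fact (i + l) i) ?leq_addr// addKn.
have H2 : 'C(m, l)%:R = m`!%:R / (l`!%:R * (m - l)`!%:R) :> R.
  apply: (canRL (mulfK _)); first by rewrite mulf_neq0.
  by rewrite -!natrM -(bin_fact lm).
rewrite H1 H2.
have -> : (-1) ^+ (i + m) = (-1) ^+ (m - l) * (-1) ^+ (i + l) :> R.
  by rewrite -exprD addnCA subnK.
by field; rewrite !fact_neq0.
Qed.

Lemma jacobiE a b n x :
  jacobi a b n x = \sum_(j < n.+1) jacobi_coef a b n j * ((x - 1) / 2) ^+ j.
Proof. by []. Qed.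

Lemma jacobi_opp a b n x : jacobi a b n (- x) = (-1) ^+ n * jacobi b a n x.
Proof.
rewrite !jacobiE mulr_sumr; pose u := (x - 1) / 2.
have -> : (- x - 1) / 2 = - (1 + u) by rewrite /u; field.
transitivity (\sum_(j < n.+1) \sum_(i < n.+1)
    jacobi_coef a b n j * (-1) ^+ j * 'C(j, i)%:R * u ^+ i).
  apply: eq_bigr => j _; rewrite [in LHS]exprNn exprDn.
  (* Extending the range of i by vanishing binomials makes it independent of j, so that the sums can
     be exchanged. *)
  rewrite (big_ord_widen n.+1 (fun i => 1 ^+ (j - i) * u ^+ i *+ 'C(j, i)))//.
  rewrite big_mkcond/= mulrA mulr_sumr; apply: eq_bigr => i _.
  case: ifPn => ij; first by rewrite expr1n mul1r -[u ^+ i *+ _]mulr_natl mulrA.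
  by rewrite bin_small ?mulr0 ?mul0r// ltnNge.
rewrite exchange_big/=; apply: eq_bigr => i _.
by rewrite -big_distrl/= jacobi_coef_reflect ?mulrA// -ltnS.
Qed.

End jacobi_reflection.

(** * Abel integrals and the fractional integrals of sums of powers *)

Section abel_integrals.
Context {R : realType}.
Implicit Types (p q s t x y : R).

(** The reflection of y into 1 - y makes this the convolution [conv_ppow] at t = 1 - x. *)
Lemma abel_integral_plus p q x : 0 < p -> 0 < q -> x < 1 ->
  (\int[mu]_(y in `]x, 1%R[) ((1 - y) `^ (p - 1) * (y - x) `^ (q - 1))%:E =
   (Gamma p * Gamma q / Gamma (p + q) * (1 - x) `^ (p + q - 1))%:E)%E.
Proof.
move=> p0 q0 x1.
rewrite EFinM -EBeta_fin// -(ppow_gt0E (p + q)) ?subr_gt0// -conv_ppow.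
rewrite (ge0_integral_reflect _ 1); last 2 first.
- exact: measurable_conv_ppow.
- by move=> y; rewrite lee_fin mulr_ge0 ?ppow_ge0.
rewrite integral_mkcond; apply: eq_integral => y _.
rewrite (_ : 1 - x - (1 - y) = y - x); last by ring.
rewrite patchE; case: ifPn.
  by rewrite inE/= in_itv/= => /andP[xy y1]; rewrite !ppow_gt0E ?subr_gt0.
rewrite notin_setE/= in_itv/= => /negP; rewrite negb_and -!leNgt => /orP[yx|y1].
  by rewrite (ppow_le0E q) ?mulr0// subr_le0.
by rewrite (ppow_le0E p) ?mul0r// subr_le0.
Qed.

(** Here a shift by 1 leads to [conv_ppow] at t = 1 + x. *)
Lemma abel_integral_minus p q x : 0 < p -> 0 < q -> -1 < x ->
  (\int[mu]_(y in `](-1)%R, x[) ((1 + y) `^ (p - 1) * (x - y) `^ (q - 1))%:E =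
   (Gamma p * Gamma q / Gamma (p + q) * (1 + x) `^ (p + q - 1))%:E)%E.
Proof.
move=> p0 q0 x1; have x10 : 0 < 1 + x by lra.
rewrite EFinM -EBeta_fin// -(ppow_gt0E (p + q))// -conv_ppow.
rewrite (ge0_integral_shift _ 1); last 2 first.
- exact: measurable_conv_ppow.
- by move=> y; rewrite lee_fin mulr_ge0 ?ppow_ge0.
rewrite integral_mkcond; apply: eq_integral => y _.
rewrite (_ : 1 + x - (y + 1) = x - y); last by ring.
rewrite [y + 1]addrC patchE; case: ifPn.
  rewrite inE/= in_itv/= => /andP[y1 yx].
  by rewrite !ppow_gt0E ?subr_gt0// -ltrBlDl sub0r.
rewrite notin_setE/= in_itv/= => /negP; rewrite negb_and -!leNgt => /orP[y1|yx].
  by rewrite (ppow_le0E p) ?mul0r//; lra.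
by rewrite (ppow_le0E q) ?mulr0// subr_le0.
Qed.

Lemma ge0_integrable_Rintegral (D : set R) (f : R -> R) (r : R) :
  measurable D -> measurable_fun setT f -> (forall y, D y -> 0 <= f y) ->
  (\int[mu]_(y in D) (f y)%:E = r%:E)%E ->
  mu.-integrable D (EFin \o f) /\ \int[mu]_(y in D) f y = r.
Proof.
move=> mD mf f0 fr; split; last by rewrite /Rintegral fr.
apply/integrableP; split.
  by apply: measurable_funTS; exact/measurable_EFinP.
under eq_integral do [rewrite /= ger0_norm; last by apply: f0; rewrite -inE].
by rewrite fr ltry.
Qed.

(** The [c j] may be negative, so linearity rests on the integrability of each [g j]. *)
Lemma Rintegral_lincomb (D : set R) (f : R -> R) (n : nat) (c v : 'I_n -> R)
    (g : 'I_n -> R -> R) :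
  measurable D ->
  (forall j, mu.-integrable D (EFin \o g j) /\ \int[mu]_(y in D) g j y = v j) ->
  (forall y, D y -> f y = \sum_(j < n) c j * g j y) ->
  mu.-integrable D (EFin \o f) /\ \int[mu]_(y in D) f y = \sum_(j < n) c j * v j.
Proof.
move=> mD gv fE.
pose h (j : 'I_n) y := ((c j)%:E * (g j y)%:E)%E.
have ih j : mu.-integrable D (h j) by apply: integrableZl => //; have [] := gv j.
have fh : {in D, (fun y => \sum_(j < n) h j y)%E =1 EFin \o f}.
  by move=> y /set_mem Dy; rewrite /= fE// sumEFin.
split; first by apply: (eq_integrable (mu:=mu) mD _ _ fh); exact: integrable_sum.
transitivity (fine (\int[mu]_(y in D) (\sum_(j < n) h j y)%E)%E).
  by rewrite /Rintegral; congr fine; apply: eq_integral => y Dy; rewrite fh.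
rewrite integral_sum// (_ : (\sum_(j < n) _)%R = (\sum_(j < n) c j * v j)%:E)//.
rewrite -sumEFin; apply: eq_bigr => j _.
have [ig <-] := gv j.
rewrite integralZl//= EFinM; congr (_ * _)%E.
by rewrite /Rintegral fineK// integrable_fin_num.
Qed.

Lemma RLorder_gt s : s < (RLorder s)%:R.
Proof. exact: truncnS_gt. Qed.

(** The kernel divides by (y - x)^(1-q) with q > 0, so each term is an Abel integral. *)
Lemma RLint_plus_sum s n (c p : 'I_n -> R) (v : R -> R) x :
  let q := (RLorder s)%:R - s in
  (forall j, 0 < p j) ->
  (forall y, -1 < y < 1 -> v y = \sum_(j < n) c j * (1 - y) `^ (p j - 1)) ->
  -1 < x < 1 ->
  mu.-integrable `]x, 1%R[ (EFin \o RLkernel_plus s v x) /\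
  RLint_plus s v x = \sum_(j < n) c j *
    (Gamma (p j) * Gamma q / Gamma (p j + q) * (1 - x) `^ (p j + q - 1)).
Proof.
move=> q p0 vE /andP[x1 x2].
have q0 : 0 < q by rewrite subr_gt0 RLorder_gt.
apply: (Rintegral_lincomb _ _ _ _ _
  (fun j y => (1 - y) `^ (p j - 1) * (y - x) `^ (q - 1))) => //.
- move=> j; apply: ge0_integrable_Rintegral => //.
  + apply: measurable_funM.
      apply: (measurableT_comp (f := fun z : R => z `^ _)); first exact: measurable_powR.
      exact: measurable_funB.
    apply: (measurableT_comp (f := fun z : R => z `^ _)); first exact: measurable_powR.
    exact: measurable_funB.
  + by move=> y _; rewrite mulr_ge0 ?powR_ge0.
  + exact: abel_integral_plus.
- move=> y/=; rewrite in_itv/= => /andP[xy y1].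
  rewrite /RLkernel_plus vE ?(lt_trans x1 xy)// mulr_suml; apply: eq_bigr => j _.
  by rewrite -powRN mulrA; congr (_ * _ `^ _); rewrite /q; ring.
Qed.

Lemma RLint_minus_sum s n (c p : 'I_n -> R) (v : R -> R) x :
  let q := (RLorder s)%:R - s in
  (forall j, 0 < p j) ->
  (forall y, -1 < y < 1 -> v y = \sum_(j < n) c j * (1 + y) `^ (p j - 1)) ->
  -1 < x < 1 ->
  mu.-integrable `](-1)%R, x[ (EFin \o RLkernel_minus s v x) /\
  RLint_minus s v x = \sum_(j < n) c j *
    (Gamma (p j) * Gamma q / Gamma (p j + q) * (1 + x) `^ (p j + q - 1)).
Proof.
move=> q p0 vE /andP[x1 x2].
have q0 : 0 < q by rewrite subr_gt0 RLorder_gt.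
apply: (Rintegral_lincomb _ _ _ _ _
  (fun j y => (1 + y) `^ (p j - 1) * (x - y) `^ (q - 1))) => //.
- move=> j; apply: ge0_integrable_Rintegral => //.
  + apply: measurable_funM.
      apply: (measurableT_comp (f := fun z : R => z `^ _)); first exact: measurable_powR.
      exact: measurable_funD.
    apply: (measurableT_comp (f := fun z : R => z `^ _)); first exact: measurable_powR.
    exact: measurable_funB.
  + by move=> y _; rewrite mulr_ge0 ?powR_ge0.
  + exact: abel_integral_minus.
- move=> y/=; rewrite in_itv/= => /andP[y1 yx].
  rewrite /RLkernel_minus vE ?y1 ?(lt_trans yx)// mulr_suml; apply: eq_bigr => j _.
  by rewrite -powRN mulrA; congr (_ * _ `^ _); rewrite /q; ring.
Qed.

End abel_integrals.

(** * Fractional derivatives of the generalized Jacobi functions *)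

Section fractional_derivatives.
Context {R : realType}.
Implicit Types (a b e s x : R).

Lemma fallingE (r : R) (m : nat) : falling r m = pochhammer (r - m%:R + 1) m.
Proof.
rewrite /falling /pochhammer (reindex_inj rev_ord_inj)/=; apply: eq_bigr => i _.
by rewrite natrB; [rewrite -natr1; ring|exact: ltn_ord].
Qed.

(** The Gamma factor completes (a+j+1)_(n-j) to Gamma(n+a+1). What remains depends on a and b only
    through a + b. *)
Lemma jacobi_coef_Gamma a b n j : -1 < a -> (j <= n)%N ->
  jacobi_coef a b n j * Gamma (a + j%:R + 1) =
  Gamma (n%:R + a + 1) *
    (pochhammer (n%:R + a + b + 1) j / (j`!%:R * (n - j)`!%:R)).
Proof.
move=> a1 jn.
have p0 : 0 < a + j%:R + 1 by have : 0 <= j%:R :> R := ler0n _ _; lra.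
rewrite (_ : n%:R + a + 1 = a + j%:R + 1 + (n - j)%:R); last by rewrite natrB//; ring.
rewrite Gamma_pochhammer// /jacobi_coef; ring.
Qed.

(* Both families of generalized Jacobi functions take this form, with [u = 1 - x]
   for [gjf_plus] and, after reflection, [u = 1 + x] for [gjf_minus]. *)
Definition jacobi_powers a b n (u : R) : R :=
  \sum_(j < n.+1) jacobi_coef a b n j * (- 2^-1) ^+ j * u `^ (a + j%:R).

Lemma powR_jacobi a b n (u : R) : 0 < u ->
  u `^ a * jacobi a b n (1 - u) = jacobi_powers a b n u.
Proof.
move=> u0; rewrite jacobiE mulr_sumr; apply: eq_bigr => j _.
rewrite powRD ?(gt_eqF u0) ?implybT// powR_mulrn ?ltW//.
rewrite (_ : (1 - u - 1) / 2 = - 2^-1 * u); last by ring.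
by rewrite exprMn; ring.
Qed.

Lemma gjf_plusE a b n x : x < 1 -> gjf_plus (- a) b n x = jacobi_powers a b n (1 - x).
Proof. by move=> x1; rewrite -powR_jacobi ?subr_gt0// subKr /gjf_plus opprK. Qed.

Lemma gjf_minusE a b n x : -1 < x ->
  gjf_minus a (- b) n x = (-1) ^+ n * jacobi_powers b a n (1 + x).
Proof.
move=> x1; have x0 : 0 < 1 + x by lra.
rewrite -powR_jacobi// /gjf_minus opprK (_ : 1 - (1 + x) = - x); last by ring.
(* Reflection exchanges a and b, and its sign cancels the one in front. *)
by rewrite jacobi_opp mulrCA (mulrA ((-1) ^+ n)) -expr2 sqrr_sign mul1r.
Qed.

(** The falling factorial equals Gamma(a+j+1+q) / Gamma(a-s+j+1), which leaves Gamma(a+j+1) /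
    Gamma(a-s+j+1). Two uses of [jacobi_coef_Gamma] then match the sides. *)
Lemma jacobi_coef_fractional s a b (n j : nat) :
  let q := (RLorder s)%:R - s in
  s - 1 < a -> -1 < a -> (j <= n)%N ->
  jacobi_coef a b n j * (Gamma (a + j%:R + 1) / Gamma (a + j%:R + 1 + q)) *
    falling (a + j%:R + 1 + q - 1) (RLorder s) =
  Gamma (n%:R + a + 1) / Gamma (n%:R + a - s + 1) * jacobi_coef (a - s) (b + s) n j.
Proof.
move=> q sa a1 jn.
have j0 : 0 <= j%:R :> R := ler0n _ _.
have n0 : 0 <= n%:R :> R := ler0n _ _.
(* This keeps every Gamma below at a positive argument, where Euler's integral is valid. *)
have as1 : -1 < a - s by lra.
have p0 : 0 < a - s + j%:R + 1 by lra.
have G3 : Gamma (n%:R + a - s + 1) != 0 by rewrite gt_eqF ?Gamma_gt0//; lra.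
have G2 : Gamma (a - s + j%:R + 1) != 0 by rewrite gt_eqF ?Gamma_gt0.
rewrite fallingE (_ : _ - (RLorder s)%:R + 1 = a - s + j%:R + 1); last first.
  by rewrite /q; ring.
have h1 := jacobi_coef_Gamma a b n j a1 jn.
have h2 := jacobi_coef_Gamma (a - s) (b + s) n j as1 jn.
have h3 := Gamma_pochhammer _ (RLorder s) p0.
rewrite (_ : a - s + j%:R + 1 + (RLorder s)%:R = a + j%:R + 1 + q) in h3; last first.
  by rewrite /q; ring.
rewrite (_ : n%:R + (a - s) + 1 = n%:R + a - s + 1) in h2; last by ring.
rewrite (_ : n%:R + (a - s) + (b + s) + 1 = n%:R + a + b + 1) in h2; last by ring.
have P0 : pochhammer (a - s + j%:R + 1) (RLorder s) != 0.
  rewrite /pochhammer; apply/prodf_neq0 => i _.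
  by rewrite gt_eqF// ltr_wpDr.
rewrite mulrA h1 -(mulfK G2 (jacobi_coef (a - s) (b + s) n j)) h2 h3.
have alg (A B G P K : R) : B != 0 -> G != 0 -> P != 0 ->
    A * K / (P * G) * P = A / B * (B * K / G).
  by move=> B0 G0 P1; field; rewrite B0 G0 P1.
exact: alg.
Qed.

(** One computation for both items: e = -1, k = 1 for [RLD_plus], and e = 1, k = (-1)^n for
    [RLD_minus]. *)
Lemma derive1n_fractional_integral s a b e k (n : nat) (F : R -> R) :
  let q := (RLorder s)%:R - s in
  s - 1 < a -> -1 < a -> `|e| = 1 ->
  (forall x, -1 < x < 1 -> F x = \sum_(j < n.+1)
    k * (jacobi_coef a b n j * (- 2^-1) ^+ j) *
    (Gamma (a + j%:R + 1) * Gamma q / Gamma (a + j%:R + 1 + q) *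
       (1 + e * x) `^ (a + j%:R + 1 + q - 1))) ->
  (forall m x, (m < RLorder s)%N -> -1 < x < 1 -> derivable (F^`(m))%classic x 1) /\
  forall x, -1 < x < 1 ->
    e ^+ RLorder s / Gamma q * (F^`(RLorder s))%classic x =
    Gamma (n%:R + a + 1) / Gamma (n%:R + a - s + 1) *
      (k * jacobi_powers (a - s) (b + s) n (1 + e * x)).
Proof.
move=> q sa a1 e1 FE.
have q0 : 0 < q by rewrite subr_gt0 RLorder_gt.
have G1 : Gamma q != 0 by rewrite gt_eqF ?Gamma_gt0.
(* One sign comes from the definition of the fractional derivative, the other from the chain
   rule. *)
have e2 : e ^+ RLorder s * e ^+ RLorder s = 1.
  by rewrite -exprMn -expr2 -(real_normK (num_real e)) e1 !expr1n.
pose c (j : 'I_n.+1) := k * (jacobi_coef a b n j * (- 2^-1) ^+ j) *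
  (Gamma (a + j%:R + 1) * Gamma q / Gamma (a + j%:R + 1 + q)).
pose r (j : 'I_n.+1) := a + j%:R + 1 + q - 1.
have FE' x : -1 < x < 1 -> F x = \sum_(j < n.+1) c j * (1 + e * x) `^ r j.
  by move=> x11; rewrite FE//; apply: eq_bigr => j _; rewrite /c !mulrA.
split; first by move=> m x _ x11; have [] := derive1n_sum_powR _ c r e F m e1 FE' x x11.
move=> x x11; have [-> _] := derive1n_sum_powR _ c r e F (RLorder s) e1 FE' x x11.
rewrite [LHS]mulr_sumr mulrA [RHS]mulr_sumr; apply: eq_bigr => j _.
have -> : r j - (RLorder s)%:R = a - s + j%:R by rewrite /r /q; ring.
have jn : (j <= n)%N by rewrite -ltnS ltn_ord.
have := jacobi_coef_fractional s a b n j sa a1 jn; rewrite -/q -/(r j) => h.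
have alg (E Q l y J A B f X : R) : Q != 0 -> E * E = 1 ->
    E / Q * (l * (y * J) * (A * Q * B) * (E * f * X)) = l * J * X * (y * (A * B) * f).
  move=> Q0 EE; rewrite -[RHS]mul1r -EE; by field.
rewrite /c [LHS]alg// h; ring.
Qed.

End fractional_derivatives.

Theorem theorem1 (R : realType) (s : R) (n : nat) (hs : 0 < s) :
  (forall alpha beta : R,
     (forall j m : nat, (1 <= j)%N -> (1 <= m)%N ->
        - (j%:R + alpha + beta) <> m%:R) ->
     s - 1 < alpha -> -1 < alpha ->
     RLD_plus_exists s (gjf_plus (- alpha) beta n) /\
     forall x : R, -1 < x < 1 ->
       RLD_plus s (gjf_plus (- alpha) beta n) x =
       Gamma (n%:R + alpha + 1) / Gamma (n%:R + alpha - s + 1)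
         * gjf_plus (- alpha + s) (beta + s) n x)
  /\
  (forall alpha beta : R,
     (forall j m : nat, (1 <= j)%N -> (1 <= m)%N ->
        - (j%:R + alpha + beta) <> m%:R) ->
     s - 1 < beta -> -1 < beta ->
     RLD_minus_exists s (gjf_minus alpha (- beta) n) /\
     forall x : R, -1 < x < 1 ->
       RLD_minus s (gjf_minus alpha (- beta) n) x =
       Gamma (n%:R + beta + 1) / Gamma (n%:R + beta - s + 1)
         * gjf_minus (alpha + s) (- beta + s) n x).

Proof.
split=> a b _ sa a1.
- pose c (j : 'I_n.+1) := 1 * (jacobi_coef a b n j * (- 2^-1) ^+ j).
  (* The exponent plus one, as in Euler's integrals; a > -1 makes it positive. *)
  pose p (j : 'I_n.+1) := a + j%:R + 1.
  have p0 j : 0 < p j by have : 0 <= j%:R :> R := ler0n _ _; rewrite /p; lra.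
  have vE y : -1 < y < 1 ->
      gjf_plus (- a) b n y = \sum_(j < n.+1) c j * (1 - y) `^ (p j - 1).
    move=> /andP[_ y1]; rewrite gjf_plusE//; apply: eq_bigr => j _.
    by rewrite /c /p addrK mul1r.
  have int x := RLint_plus_sum s n.+1 c p _ x p0 vE.
  have [dF FE] := derive1n_fractional_integral s a b (- 1) 1 n
    (RLint_plus s (gjf_plus (- a) b n)) sa a1 (normrN1 R)
    (fun x x11 => etrans (int x x11).2
      (eq_bigr _ (fun j _ => congr1 (fun t => _ * (_ * t `^ _))
         (congr1 (fun t => 1 + t) (esym (mulN1r x)))))).
  split; first by split=> // x /int[].
  move=> x x11; rewrite /RLD_plus FE// mulN1r mul1r.
  (* The superscript -a + s is read as -(a - s), the form that [gjf_plusE] expands. *)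
  rewrite -[in RHS](opprK (- a + s)) gjf_plusE; last by case/andP: x11.
  by rewrite opprD opprK.
(* Here a and b exchange roles, and (-1)^n is the sign of the reflection. *)
- pose c (j : 'I_n.+1) := (-1) ^+ n * (jacobi_coef b a n j * (- 2^-1) ^+ j).
  pose p (j : 'I_n.+1) := b + j%:R + 1.
  have p0 j : 0 < p j by have : 0 <= j%:R :> R := ler0n _ _; rewrite /p; lra.
  have vE y : -1 < y < 1 ->
      gjf_minus a (- b) n y = \sum_(j < n.+1) c j * (1 + y) `^ (p j - 1).
    move=> /andP[y1 _]; rewrite gjf_minusE// mulr_sumr; apply: eq_bigr => j _.
    by rewrite /c /p addrK !mulrA.
  have int x := RLint_minus_sum s n.+1 c p _ x p0 vE.
  have [dF FE] := derive1n_fractional_integral s b a 1 ((-1) ^+ n) n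
    (RLint_minus s (gjf_minus a (- b) n)) sa a1 (normr1 R)
    (fun x x11 => etrans (int x x11).2
      (eq_bigr _ (fun j _ => congr1 (fun t => _ * (_ * t `^ _))
         (congr1 (fun t => 1 + t) (esym (mul1r x)))))).
  split; first by split=> // x /int[].
  move=> x x11; move: (FE x x11); rewrite /RLD_minus expr1n mul1r => ->.
  rewrite -[in RHS](opprK (- b + s)) gjf_minusE; last by case/andP: x11.
  by rewrite mul1r opprD opprK.
Qed.
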